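(* Let $\Bbbk$ be a commutative $\mathbb{Z}[1/6,\mathbf{n}]$-algebra. The $\Bbbk$-linear tensor ideal of $\Bbbk\mathcal{T}$ generated by the fundamental relation and the reduction rules (F1)–(F5) (all listed in the context) contains $p^{(F)}(\mathbf{n})\,[\,]$, where $[\,]$ is the empty diagram and $$p^{(F)}(\mathbf{n}) = (\mathbf{n}-26)(\mathbf{n}-14)(\mathbf{n}-8)(\mathbf{n}-5)(\mathbf{n}-2)^2\,\mathbf{n}\,(\mathbf{n}+1)(\mathbf{n}+2).$$
   Context: $\mathbb{Z}[1/6,\mathbf{n}]$ is the polynomial ring in the formal variable $\mathbf{n}$ over $\mathbb{Z}[1/6]$. A string diagram is a finite (multi)graph, loops and multiple edges allowed, with numbered univalent boundary points, all other vertices trivalent, possibly together with finitely many vertex-free circles and vertex-free arcs joining two boundary points. Diagrams are considered up to isomorphism fixing the boundary points (there is no planarity and no cyclic order at vertices). A closed diagram has no boundary points; $[\,]$ is the empty diagram. $\mathcal{T}$ is the cobordism category of trivalent graphs: objects are natural numbers, morphisms $r\to s$ are string diagrams with $r+s$ boundary points, composition is gluing along boundary points, tensor product is disjoint union. It is a strict rigid symmetric monoidal category. $\Bbbk\mathcal{T}$ is the free $\Bbbk$-linear category on $\mathcal{T}$ (morphisms are finite $\Bbbk$-linear combinations of diagrams). The tensor ideal generated by a set of relations is the smallest family of $\Bbbk$-submodules of the morphism modules that contains the differences of the two sides of the relations and is closed under composition and tensor product with arbitrary morphisms; thus its closed part is spanned by all results of gluing a relation into an arbitrary diagram with matching boundary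 so as to close it up. Four-point diagrams, with boundary points $1,2,3,4$ (in cyclic order): - $K$: two trivalent vertices joined by an edge, one attached to boundary points $1,2$, the other to $3,4$; - $H$: the same with the pairs $\{2,3\}$ and $\{1,4\}$; - $A$: the same with the pairs $\{1,3\}$ and $\{2,4\}$; - $I$: two arcs $1$–$4$ and $2$–$3$; $U$: two arcs $1$–$2$ and $3$–$4$; $X$: two arcs $1$–$3$ and $2$–$4$; - $S$ (square): a 4-cycle of trivalent vertices $v_1v_2v_3v_4$ with $v_i$ attached to boundary point $i$. Fundamental relation: $K+H+A = 2I+2U+2X$. Reduction rules: (F1) a vertex-free circle equals $\mathbf{n}\,[\,]$; (F2) the tadpole (one trivalent vertex with a loop, and one boundary point) equals $0$; (F3) the bigon (two trivalent vertices joined by two edges, each with one leg to the boundary) equals $(\mathbf{n}+2)$ times the arc joining its two boundary points; (F4) the triangle (a 3-cycle of trivalent vertices each with one leg to the boundary) equals $\tfrac12(2-\mathbf{n})$ times the single trivalent vertex with the same three boundary points; (F5) $S = \tfrac{6-\mathbf{n}}{2}A+\tfrac{3\mathbf{n}+2}{2}I+\tfrac{3\mathbf{n}+2}{2}U-\tfrac{\mathbf{n}+6}{2}X$. *)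

(* Defs.v *)
From HB Require Import structures.
From mathcomp Require Import all_boot all_order all_algebra.
From mathcomp Require Import finmap.
From mathcomp Require Import boolp.
From mathcomp Require Import monalg.

Set Implicit Arguments.
Unset Strict Implicit.
Unset Printing Implicit Defensive.

Import GRing.Theory Num.Theory.
Local Open Scope ring_scope.
Local Open Scope quotient_scope.

(** Z[1/6] is the subring of the rationals whose denominators have no prime
    factor other than 2 and 3. *)
Definition six_denominator : {pred rat} :=
  fun x => [pred p : nat | (p == 2) || (p == 3)].-nat `|denq x|%N.

Lemma six_denominatorP (x : rat) :
  reflect (exists2 m : nat, [pred p : nat | (p == 2) || (p == 3)].-nat m &
             x * m%:R \is a Num.int)
          (x \in six_denominator).
Proof.
apply: (iffP idP) => [xP|[m m23 /intrP [z xm]]].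
  exists `|denq x|%N => //.
  by rewrite pmulrn absz_denq -numqE intr_int.
rewrite unfold_in; apply: pnat_dvd m23.
have e : numq x * m%:Z = z * denq x.
  apply: (@intr_inj rat); rewrite !intrM -xm numqE.
  by rewrite mulrAC -pmulrn.
change (denq x %| m%:Z)%Z.
rewrite -(@Gauss_dvdzr _ (numq x)); last first.
  by rewrite coprimezE coprime_sym coprime_num_den.
by rewrite e dvdz_mull.
Qed.

Fact six_denominator_subring : subring_closed six_denominator.
Proof.
split=> [|x y|x y].
- by apply/six_denominatorP; exists 1%N; rewrite ?mulr1.
- move=> /six_denominatorP[m m6 xm] /six_denominatorP[p p6 yp].
  apply/six_denominatorP; exists (m * p)%N; first by rewrite pnatM m6.
  have -> : (x - y) * (m * p)%:R = x * m%:R * p%:R - y * p%:R * m%:R.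
    by rewrite natrM mulrBl -!mulrA [p%:R * m%:R]mulrC.
  by rewrite rpredB // rpredM // rpred_nat.
- move=> /six_denominatorP[m m6 xm] /six_denominatorP[p p6 yp].
  apply/six_denominatorP; exists (m * p)%N; first by rewrite pnatM m6.
  by rewrite natrM mulrACA rpredM.
Qed.

HB.instance Definition _ :=
  GRing.isSubringClosed.Build rat six_denominator six_denominator_subring.

Record Zsixth : predArgType :=
  ToZsixth { rat_of_Zsixth :> rat; _ : rat_of_Zsixth \in six_denominator }.

HB.instance Definition _ := [isSub for rat_of_Zsixth].
HB.instance Definition _ := [Choice of Zsixth by <:].
HB.instance Definition _ := [SubChoice_isSubComNzRing of Zsixth by <:].

Definition inv2 : Zsixth := @ToZsixth (2%:R^-1) isT.

Local Close Scope ring_scope.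

(** Incidence code of a string diagram.  Every strand (edge, leg or arc with
    two ends) carries a label in [nat].  The code lists the number of
    vertex-free circles, the label of the strand ending at each boundary point
    in turn, and for each trivalent vertex the labels of the three strands
    ending there; a loop contributes its label twice to the same vertex. *)
Definition code : Type := (nat * seq nat * seq (seq nat))%type.
Definition circles (d : code) : nat := d.1.1.
Definition boundary (d : code) : seq nat := d.1.2.
Definition vertices (d : code) : seq (seq nat) := d.2.

Definition strand_ends (b : seq nat) (vs : seq (seq nat)) : seq nat :=
  b ++ flatten vs.

Definition valid (m : nat) (d : code) : bool :=
  let e := strand_ends (boundary d) (vertices d) in
  [&& size (boundary d) == m,
      all (fun v => size v == 3) (vertices d) &
      all (fun x => count_mem x e == 2) e].

Record diagram (m : nat) : predArgType :=
  Diagram { code_of :> code; code_ofP : valid m code_of }.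

HB.instance Definition _ m := [isSub for @code_of m].
HB.instance Definition _ m := [Choice of diagram m by <:].

Definition relabel (f : nat -> nat) : seq (seq nat) -> seq (seq nat) :=
  map (map f).

(** Vertices carry neither an order among them nor an order of their legs. *)
Definition same_vertices (vs ws : seq (seq nat)) : bool :=
  perm_eq (map (sort leq) vs) (map (sort leq) ws).

Definition code_iso (d e : code) : Prop :=
  circles d = circles e /\
  exists f : nat -> nat,
    [/\ {in strand_ends (boundary d) (vertices d) &, injective f},
        map f (boundary d) = boundary e &
        same_vertices (relabel f (vertices d)) (vertices e)].

Lemma same_vertices_relabel f vs ws :
  same_vertices vs ws -> same_vertices (relabel f vs) (relabel f ws).
Proof.
have sortE us : map (sort leq) (relabel f us) =
                map (sort leq \o map f) (map (sort leq) us).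
  rewrite -!map_comp; apply: eq_map => v /=.
  apply/perm_sortP; [exact: leq_total|exact: leq_trans|exact: anti_leq|].
  by rewrite perm_map // perm_sym perm_sort.
by rewrite /same_vertices !sortE => /(perm_map (sort leq \o map f)).
Qed.

Lemma same_vertices_flatten vs ws :
  same_vertices vs ws -> perm_eq (flatten vs) (flatten ws).
Proof.
have sortE us : perm_eq (flatten (map (sort leq) us)) (flatten us).
  elim: us => //= u us IH; rewrite perm_cat //.
  by rewrite perm_sort.
move=> /perm_flatten h; apply: perm_trans (sortE ws).
by apply: perm_trans h; rewrite perm_sym.
Qed.

Lemma strand_ends_relabel f b vs : strand_ends (map f b) (relabel f vs) = map f (strand_ends b vs).
Proof. by rewrite /strand_ends map_cat map_flatten. Qed.

Lemma code_iso_refl d : code_iso d d.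
Proof.
split=> //; exists id; split=> //; first by rewrite map_id.
rewrite /relabel (eq_map (g := id)) ?map_id /same_vertices //.
by move=> v /=; rewrite map_id.
Qed.

Lemma code_iso_mem d e (f : nat -> nat) :
  map f (boundary d) = boundary e ->
  same_vertices (relabel f (vertices d)) (vertices e) ->
  strand_ends (boundary e) (vertices e)
    =i map f (strand_ends (boundary d) (vertices d)).
Proof.
move=> <- /same_vertices_flatten /perm_mem h x.
by rewrite -strand_ends_relabel !mem_cat h.
Qed.

Lemma relabel_comp f g vs : relabel f (relabel g vs) = relabel (f \o g) vs.
Proof. by rewrite /relabel -map_comp; apply: eq_map => v /=; rewrite map_comp. Qed.

Lemma eq_relabel f g : f =1 g -> relabel f =1 relabel g.
Proof. by move=> fg vs; apply: eq_map => v; apply: eq_map. Qed.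

Lemma eq_in_relabel b (f g : nat -> nat) vs :
  {in strand_ends b vs, f =1 g} -> relabel f vs = relabel g vs.
Proof.
move=> h; apply/eq_in_map => v vin; apply/eq_in_map => x xin; apply: h.
by rewrite mem_cat; apply/orP; right; apply/flattenP; exists v.
Qed.

Lemma eq_in_boundary b (f g : nat -> nat) vs :
  {in strand_ends b vs, f =1 g} -> map f b = map g b.
Proof. by move=> h; apply/eq_in_map => x xin; apply: h; rewrite mem_cat xin. Qed.

Lemma code_iso_sym d e : code_iso d e -> code_iso e d.
Proof.
move=> [ec [f [f_inj fb fv]]]; split=> //.
have me := code_iso_mem fb fv.
set L := strand_ends _ _ in f_inj me.
pose h y := nth 0 L (index y (map f L)).
have fK : {in L, cancel f h}.
  move=> x xL; have fxL : f x \in map f L by rewrite map_f.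
  have iL : (index (f x) (map f L) < size L) by rewrite -(size_map f) index_mem.
  by apply: f_inj; rewrite ?mem_nth // -(nth_map _ 0) // nth_index.
exists h; split.
- by move=> x y; rewrite !me => /mapP[u uL ->] /mapP[v vL ->]; rewrite !fK // => ->.
- rewrite -fb -map_comp -[RHS]map_id.
  by apply: (@eq_in_boundary _ _ _ (vertices d)) => x /fK.
- have := same_vertices_relabel h fv.
  rewrite relabel_comp (@eq_in_relabel (boundary d) _ id); last by move=> x /fK.
  rewrite /same_vertices perm_sym /relabel (eq_map (f := map id) (g := id)) ?map_id //.
  exact: map_id.
Qed.

Lemma code_iso_trans e d d' : code_iso d e -> code_iso e d' -> code_iso d d'.
Proof.
move=> [ec [f [f_inj fb fv]]] [ec' [g [g_inj gb gv]]]; split; first by rewrite ec.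
have me := code_iso_mem fb fv.
exists (g \o f); split.
- move=> x y xL yL /= gfxy; apply: f_inj => //.
  by apply: g_inj => //; rewrite me map_f.
- by rewrite map_comp fb.
- have := same_vertices_relabel g fv; rewrite relabel_comp /same_vertices.
  by move/perm_trans; apply.
Qed.

Definition diagram_eq m (d e : diagram m) : bool := `[< code_iso d e >].

Fact diagram_eq_refl m : reflexive (@diagram_eq m).
Proof. by move=> d; apply/asboolP/code_iso_refl. Qed.

Fact diagram_eq_sym m : symmetric (@diagram_eq m).
Proof. by move=> d e; apply/asboolP/asboolP => /code_iso_sym. Qed.

Fact diagram_eq_trans m : transitive (@diagram_eq m).
Proof.
by move=> e d d' /asboolP de /asboolP ed'; apply/asboolP/(code_iso_trans de).
Qed.

Canonical diagram_equiv m :=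
  EquivRel (@diagram_eq m) (@diagram_eq_refl m) (@diagram_eq_sym m)
    (@diagram_eq_trans m).

(** A morphism [r -> s] is a class of diagrams with [r + s] boundary points:
    first the [r] source points, then the [s] target points. *)
Definition Hom (r s : nat) : Type := {eq_quot (diagram_equiv (r + s))}.

HB.instance Definition _ r s := Choice.on (Hom r s).
HB.instance Definition _ r s := EqQuotient.on (Hom r s).

(** Each pair of [ps] is made of the labels of the two strand ends that are
    glued at one point.  The glued strands become one, so [y] is renamed into
    [x], except when both ends already belong to the same strand, which closes
    up into a vertex-free circle.  [glue g ps] returns the number of circles so
    created and the final renaming, [g] being the renaming done so far. *)
Fixpoint glue (g : nat -> nat) (ps : seq (nat * nat)) : nat * (nat -> nat) :=
  if ps is (x0, y0) :: ps' then
    let x := g x0 in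
    let y := g y0 in
    if x == y then let h := glue g ps' in (h.1.+1, h.2)
    else glue (fun z => if g z == y then x else g z) ps'
  else (0, g).

(** The labels of two diagrams are made disjoint by [double] on the first one
    and [doubleS] on the second one. *)
Definition doubleS (x : nat) : nat := x.*2.+1.

Definition union_vertices (d e : code) : seq (seq nat) :=
  relabel double (vertices d) ++ relabel doubleS (vertices e).

Definition compose_code (r s : nat) (d e : code) : code :=
  let bd := map double (boundary d) in
  let be := map doubleS (boundary e) in
  let h := glue id (zip (drop r bd) (take s be)) in
  (circles d + circles e + h.1,
   map h.2 (take r bd ++ drop s be),
   relabel h.2 (union_vertices d e)).

Definition tensor_code (r1 r2 : nat) (d e : code) : code :=
  let bd := map double (boundary d) in
  let be := map doubleS (boundary e) in
  (circles d + circles e,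
   take r1 bd ++ take r2 be ++ drop r1 bd ++ drop r2 be,
   union_vertices d e).

Definition twice (e : seq nat) : bool := all (fun x => count_mem x e == 2) e.

Lemma twiceP e : reflect {in e, forall x, count_mem x e = 2} (twice e).
Proof. by apply: (iffP allP) => h x /h /eqP. Qed.

Lemma twice_perm e e' : perm_eq e e' -> twice e = twice e'.
Proof.
move=> ee'; rewrite /twice (perm_all _ ee'); apply: eq_all => x.
by move/permP: ee' => ->.
Qed.

Lemma twice_map f e : {in e &, injective f} -> twice e -> twice (map f e).
Proof.
move=> f_inj /twiceP te; apply/twiceP => _ /mapP[x xe ->].
rewrite count_map -(te x xe); apply: eq_in_count => y ye /=.
by apply/eqP/eqP => [/f_inj->|->].
Qed.

Lemma twice_cat e e' :
  {in e & e', forall x y, x != y} -> twice e -> twice e' -> twice (e ++ e').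
Proof.
move=> dis /twiceP te /twiceP te'; apply/twiceP => x.
rewrite mem_cat count_cat => /orP[xe|xe].
  rewrite te // [X in (_ + X)](_ : _ = 0) //; apply/count_memPn.
  by apply/negP => xe'; have := dis _ _ xe xe'; rewrite eqxx.
rewrite te' // [X in (X + _)](_ : _ = 0) //; apply/count_memPn.
by apply/negP => xe'; have := dis _ _ xe' xe; rewrite eqxx.
Qed.

Lemma glue_twice ps g e :
  twice (map g (unzip1 ps ++ unzip2 ps ++ e)) -> twice (map (glue g ps).2 e).
Proof.
elim: ps g => [//|[x0 y0] ps IH] g tw /=.
set L := unzip1 ps ++ unzip2 ps ++ e.
have {tw} /twiceP tw : twice [:: g x0, g y0 & map g L].
  rewrite -(twice_perm _ (e := map g (unzip1 ((x0, y0) :: ps) ++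
    unzip2 ((x0, y0) :: ps) ++ e))) // (@perm_map _ _ g _ [:: x0, y0 & L]) //.
  by rewrite /= perm_cons -cat1s perm_catCA.
case: eqVneq => [gxy|gxy] /=; apply: IH; rewrite -/L.
  apply/twiceP => z zL; have := tw z; rewrite !inE zL !orbT => /(_ isT) /=.
  rewrite -gxy; suff /negbTE -> : g x0 != z by rewrite !add0n.
  apply/eqP => xz; have := tw z; rewrite !inE zL !orbT => /(_ isT) /=.
  rewrite -gxy xz eqxx !add1n => -[] /eqP.
  by rewrite -leqn0 leqNgt -has_count has_pred1 zL.
pose f z := if z == g y0 then g x0 else z.
have -> : [seq if g z == g y0 then g x0 else g z | z <- L] = map f (map g L).
  by rewrite -map_comp.
have cx : count_mem (g x0) (map g L) = 1.
  by have := tw (g x0); rewrite inE eqxx /= eqxx eq_sym (negbTE gxy) => /(_ isT) [].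
have cy : count_mem (g y0) (map g L) = 1.
  have := tw (g y0); rewrite !inE eqxx orbT /= eqxx (negbTE gxy).
  by move=> /(_ isT) [].
apply/twiceP => w; have [-> _|wx wL] := eqVneq w (g x0).
  rewrite count_map -[2]/(1 + 1) -{1}cx -cy -count_predUI.
  rewrite [X in (_ + X)](_ : _ = 0) ?addn0; last first.
    by rewrite -(count_pred0 (map g L)); apply: eq_count => z /=; case: eqVneq => [->|//];
       rewrite (negbTE gxy).
  apply: eq_count => z /=; rewrite /f; case: (z =P g y0) => [->|_]; rewrite ?eqxx ?orbT ?orbF //.
have wy : w != g y0.
  by apply: contraTneq wL => ->; apply/mapP => -[z _]; rewrite /f; case: eqVneq => [|zy ez];
     [move/eqP: gxy => gxy _ /esym | rewrite ez eqxx in zy].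
have wL' : w \in map g L.
  move: wL => /mapP[z zL ->]; rewrite /f; case: eqVneq => // zy.
  by have := has_pred1 (g x0) (map g L); rewrite has_count cx => <-.
have := tw w; rewrite !inE wL' !orbT /= => /(_ isT).
rewrite ![_ == w]eq_sym (negbTE wx) (negbTE wy) !add0n => <-.
rewrite count_map; apply: eq_count => z /=; rewrite /f.
case: (z =P g y0) => [->|//]; rewrite ![_ == w]eq_sym.
by rewrite (negbTE wx) (negbTE wy).
Qed.

Lemma double_inj : injective double.
Proof. by move=> x y /(congr1 half); rewrite !doubleK. Qed.

Lemma doubleS_inj : injective doubleS.
Proof. by move=> x y [] /double_inj. Qed.

Lemma double_neq_doubleS x y : double x != doubleS y.
Proof. by apply/eqP => /(congr1 odd); rewrite /= !odd_double. Qed.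

Lemma flatten_union d e :
  flatten (union_vertices d e) =
    map double (flatten (vertices d)) ++ map doubleS (flatten (vertices e)).
Proof. by rewrite flatten_cat !map_flatten. Qed.

Lemma all_size3_relabel f vs :
  all (fun v => size v == 3) (relabel f vs) = all (fun v => size v == 3) vs.
Proof. by rewrite all_map; apply: eq_all => v /=; rewrite size_map. Qed.

Lemma union_vertices_size m p (d : diagram m) (e : diagram p) :
  all (fun v => size v == 3) (union_vertices (code_of d) (code_of e)).
Proof.
rewrite all_cat !all_size3_relabel.
by case/and3P: (code_ofP d) => _ -> _; case/and3P: (code_ofP e) => _ -> _.
Qed.

Lemma twice_union m p (d : diagram m) (e : diagram p) :
  twice (map double (boundary (code_of d)) ++ map doubleS (boundary (code_of e))
         ++ flatten (union_vertices (code_of d) (code_of e))).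
Proof.
have /and3P[_ _ td] := code_ofP d; have /and3P[_ _ te] := code_ofP e.
have dis : {in map double (strand_ends (boundary (code_of d)) (vertices (code_of d)))
   & map doubleS (strand_ends (boundary (code_of e)) (vertices (code_of e))),
   forall x y, x != y}.
  by move=> _ _ /mapP[x _ ->] /mapP[y _ ->]; exact: double_neq_doubleS.
have := twice_cat dis (twice_map (in2W double_inj) td)
                      (twice_map (in2W doubleS_inj) te).
rewrite /strand_ends !map_cat flatten_union -!catA.
by rewrite (twice_perm (e' := map double (boundary (code_of d)) ++
  map doubleS (boundary (code_of e)) ++ map double (flatten (vertices (code_of d))) ++
  map doubleS (flatten (vertices (code_of e))))) // perm_cat2l perm_catCA.
Qed.

Fact compose_valid r s t (d : diagram (r + s)) (e : diagram (s + t)) :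
  valid (r + t) (compose_code r s (code_of d) (code_of e)).
Proof.
have /and3P[/eqP sd _ _] := code_ofP d; have /and3P[/eqP se _ _] := code_ofP e.
set bd := map double (boundary (code_of d)).
set be := map doubleS (boundary (code_of e)).
have sbd : size bd = r + s by rewrite size_map.
have sbe : size be = s + t by rewrite size_map.
have srd : size (take r bd) = r by rewrite size_takel // sbd leq_addr.
have sde : size (drop s be) = t by rewrite size_drop sbe addKn.
have szd : size (drop r bd) = s by rewrite size_drop sbd addKn.
have sze : size (take s be) = s by rewrite size_takel // sbe leq_addr.
apply/and3P; split.
- by rewrite /= size_map size_cat srd sde.
- by rewrite /= all_size3_relabel union_vertices_size.
- rewrite /= strand_ends_relabel.
  apply: glue_twice; rewrite map_id unzip1_zip ?szd ?sze // unzip2_zip ?szd ?sze //.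
  have := twice_union d e; rewrite -/bd -/be /strand_ends.
  rewrite -{1}(cat_take_drop r bd) -{1}(cat_take_drop s be) -!catA.
  apply: etrans; apply: twice_perm.
  by rewrite catA perm_catCA -catA.
Qed.

Fact tensor_valid r1 s1 r2 s2 (d : diagram (r1 + s1)) (e : diagram (r2 + s2)) :
  valid ((r1 + r2) + (s1 + s2)) (tensor_code r1 r2 (code_of d) (code_of e)).
Proof.
have /and3P[/eqP sd _ _] := code_ofP d; have /and3P[/eqP se _ _] := code_ofP e.
apply/and3P; split.
- rewrite /= !size_cat !size_drop !size_takel ?size_map ?sd ?se ?leq_addr //.
  by rewrite !addKn addnA.
- exact: union_vertices_size.
- have := twice_union d e; rewrite -/(twice _) /strand_ends /=.
  set bd := map double _; set be := map doubleS _.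
  rewrite -{1}(cat_take_drop r1 bd) -{1}(cat_take_drop r2 be) -!catA.
  apply: etrans; apply: twice_perm.
  by rewrite perm_cat2l perm_catCA.
Qed.

Lemma glue_relabel (f : nat -> nat) (L : seq nat) ps (g g' : nat -> nat) :
    {in L &, injective f} ->
    {subset unzip1 ps <= L} -> {subset unzip2 ps <= L} ->
    {in L, forall z, g z \in L} -> {in L, forall z, g' (f z) = f (g z)} ->
  let h := glue g ps in
  let h' := glue g' [seq (f p.1, f p.2) | p <- ps] in
  [/\ h'.1 = h.1, {in L, forall z, h.2 z \in L} &
      {in L, forall z, h'.2 (f z) = f (h.2 z)}].
Proof.
move=> f_inj; elim: ps g g' => [//|[x0 y0] ps IH] g g' /= s1 s2 gL gf.
have xL : x0 \in L by apply: s1; rewrite inE eqxx.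
have yL : y0 \in L by apply: s2; rewrite inE eqxx.
have {}s1 : {subset unzip1 ps <= L} by move=> z zL; apply: s1; rewrite inE zL orbT.
have {}s2 : {subset unzip2 ps <= L} by move=> z zL; apply: s2; rewrite inE zL orbT.
have feq a b : a \in L -> b \in L -> (f a == f b) = (a == b).
  by move=> aL bL; apply/eqP/eqP => [/f_inj->|->].
rewrite !gf // feq ?gL //; case: eqVneq => _ /=.
  by case: (IH _ _ s1 s2 gL gf) => -> ? ?.
apply: IH => // z zL; first by case: ifP => _; apply: gL.
by rewrite gf // feq ?gL //; case: ifP.
Qed.

Lemma mem_unzip1 (s t : seq nat) : {subset unzip1 (zip s t) <= s}.
Proof.
elim: s t => [|x s IH] [|y t] //= z; rewrite !inE => /orP[->//|/IH->].
by rewrite orbT.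
Qed.

Lemma mem_unzip2 (s t : seq nat) : {subset unzip2 (zip s t) <= t}.
Proof.
elim: s t => [|x s IH] [|y t] //= z; rewrite !inE => /orP[->//|/IH->].
by rewrite orbT.
Qed.

Lemma zip_map_both (f : nat -> nat) (s t : seq nat) :
  zip (map f s) (map f t) = [seq (f p.1, f p.2) | p <- zip s t].
Proof. by elim: s t => [|x s IH] [|y t] //=; rewrite IH. Qed.

Lemma same_vertices_cat vs vs' ws ws' :
  same_vertices vs ws -> same_vertices vs' ws' ->
  same_vertices (vs ++ vs') (ws ++ ws').
Proof. by rewrite /same_vertices !map_cat; exact: perm_cat. Qed.

Section UnionRelabel.
Variables (d d' e e' : code) (f k : nat -> nat).
Hypothesis f_inj : {in strand_ends (boundary d) (vertices d) &, injective f}.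
Hypothesis k_inj : {in strand_ends (boundary e) (vertices e) &, injective k}.
Hypothesis fv : same_vertices (relabel f (vertices d)) (vertices d').
Hypothesis kv : same_vertices (relabel k (vertices e)) (vertices e').

Definition union_relabeling (z : nat) : nat :=
  if odd z then doubleS (k z./2) else double (f z./2).

Lemma union_relabeling1 z : union_relabeling (double z) = double (f z).
Proof. by rewrite /union_relabeling odd_double doubleK. Qed.

Lemma union_relabeling2 z : union_relabeling (doubleS z) = doubleS (k z).
Proof. by rewrite /union_relabeling /= odd_double /= uphalf_double. Qed.

Definition union_labels : seq nat :=
  map double (strand_ends (boundary d) (vertices d)) ++
  map doubleS (strand_ends (boundary e) (vertices e)).

Lemma union_relabeling_inj : {in union_labels &, injective union_relabeling}.
Proof.
move=> x y; rewrite !mem_cat => /orP[]/mapP[u uL ->] /orP[]/mapP[v vL ->].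
- by rewrite !union_relabeling1 => /double_inj/f_inj->.
- by rewrite union_relabeling1 union_relabeling2 => /eqP; rewrite (negbTE (double_neq_doubleS _ _)).
- by rewrite union_relabeling1 union_relabeling2 => /esym/eqP; rewrite (negbTE (double_neq_doubleS _ _)).
- by rewrite !union_relabeling2 => /doubleS_inj/k_inj->.
Qed.

Lemma union_same_vertices :
  same_vertices (relabel union_relabeling (union_vertices d e))
                (union_vertices d' e').
Proof.
rewrite /relabel map_cat -![map (map union_relabeling) _]/(relabel _ _).
rewrite !relabel_comp; apply: same_vertices_cat.
- have := same_vertices_relabel double fv; rewrite relabel_comp.
  by rewrite (@eq_relabel (union_relabeling \o double) (double \o f)) //; exact: union_relabeling1.
- have := same_vertices_relabel doubleS kv; rewrite relabel_comp.
  by rewrite (@eq_relabel (union_relabeling \o doubleS) (doubleS \o k)) //; exact: union_relabeling2.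
Qed.

End UnionRelabel.

Lemma code_iso_compose r s d d' e e' :
  code_iso d d' -> code_iso e e' ->
  code_iso (compose_code r s d e) (compose_code r s d' e').
Proof.
move=> [cd [f [f_inj fb fv]]] [ce [k [k_inj kb kv]]].
set R := union_relabeling f k.
have R_inj : {in union_labels d e &, injective R} by exact: union_relabeling_inj.
have Rv : same_vertices (relabel R (union_vertices d e)) (union_vertices d' e').
  exact: union_same_vertices.
set bd := map double (boundary d); set be := map doubleS (boundary e).
have bd' : map double (boundary d') = map R bd.
  by rewrite -fb -!map_comp; apply: eq_map => z /=; rewrite /R union_relabeling1.
have be' : map doubleS (boundary e') = map R be.
  by rewrite -kb -!map_comp; apply: eq_map => z /=; rewrite /R union_relabeling2.
have sbd : {subset bd <= union_labels d e}.
  by move=> z; rewrite /union_labels !map_cat !mem_cat => ->.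
have sbe : {subset be <= union_labels d e}.
  by move=> z; rewrite /union_labels !map_cat !mem_cat => ->; rewrite orbT.
have sv : {subset flatten (union_vertices d e) <= union_labels d e}.
  move=> z; rewrite flatten_union /union_labels !map_cat !mem_cat.
  by case/orP => ->; rewrite !orbT.
set ps := zip (drop r bd) (take s be).
have ps1 : {subset unzip1 ps <= union_labels d e}.
  by move=> z /mem_unzip1/mem_drop/sbd.
have ps2 : {subset unzip2 ps <= union_labels d e}.
  by move=> z /mem_unzip2/mem_take/sbe.
have [h1 hL hR] := @glue_relabel R _ ps id id R_inj ps1 ps2 (fun z zL => zL) (fun z _ => erefl).
have eps : zip (drop r (map R bd)) (take s (map R be)) = [seq (R p.1, R p.2) | p <- ps].
  by rewrite -map_drop -map_take zip_map_both.
have hends : {subset strand_ends (take r bd ++ drop s be) (union_vertices d e) <= union_labels d e}.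
  by move=> z; rewrite /strand_ends mem_cat [X in X || _]mem_cat -orbA => /or3P[/mem_take/sbd|/mem_drop/sbe|/sv] //.
have com : {in strand_ends (take r bd ++ drop s be) (union_vertices d e),
    (glue id [seq (R p.1, R p.2) | p <- ps]).2 \o R =1 R \o (glue id ps).2}.
  by move=> y /hends /hR.
rewrite /compose_code bd' be' eps -/bd -/be -/ps; split=> /=.
  by rewrite cd ce h1.
exists R; split.
- move=> x y; rewrite /= !strand_ends_relabel => /mapP[u /hends uL ->] /mapP[v /hends vL ->].
  by apply: R_inj; apply: hL.
- rewrite /= -map_take -map_drop -map_cat -!map_comp.
  by apply/esym; exact: eq_in_boundary com.
- rewrite /= relabel_comp -(eq_in_relabel com) -relabel_comp.
  exact: same_vertices_relabel.
Qed.

Lemma code_iso_tensor r1 r2 d d' e e' :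
  code_iso d d' -> code_iso e e' ->
  code_iso (tensor_code r1 r2 d e) (tensor_code r1 r2 d' e').
Proof.
move=> [cd [f [f_inj fb fv]]] [ce [k [k_inj kb kv]]].
set R := union_relabeling f k.
have bd' : map double (boundary d') = map R (map double (boundary d)).
  by rewrite -fb -!map_comp; apply: eq_map => z /=; rewrite /R union_relabeling1.
have be' : map doubleS (boundary e') = map R (map doubleS (boundary e)).
  by rewrite -kb -!map_comp; apply: eq_map => z /=; rewrite /R union_relabeling2.
rewrite /tensor_code; split=> /=; first by rewrite cd ce.
exists R; split; last exact: union_same_vertices.
- suff sub : {subset strand_ends (boundary (tensor_code r1 r2 d e)) (union_vertices d e)
                <= union_labels d e}.
    by move=> x y /sub xL /sub yL; exact: (union_relabeling_inj f_inj k_inj xL yL).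
  move=> z; rewrite /union_labels /strand_ends flatten_union !map_cat !mem_cat.
  rewrite -!orbA => /or4P[/mem_take->|/mem_take->|/mem_drop->|]; rewrite ?orbT //.
  by case/or3P => [/mem_drop->|->|->]; rewrite ?orbT.
- by rewrite bd' be' !map_cat !map_take !map_drop.
Qed.

Definition compose_diagram r s t (d : diagram (r + s)) (e : diagram (s + t)) :
  diagram (r + t) := Diagram (compose_valid d e).

Definition tensor_diagram r1 s1 r2 s2
    (d : diagram (r1 + s1)) (e : diagram (r2 + s2)) :
  diagram ((r1 + r2) + (s1 + s2)) := Diagram (tensor_valid d e).

(** Composition is written in diagrammatic order. *)
Definition hcomp r s t (x : Hom r s) (y : Hom s t) : Hom r t :=
  \pi_(Hom r t) (compose_diagram (repr x) (repr y)).

Definition htensor r1 s1 r2 s2 (x : Hom r1 s1) (y : Hom r2 s2) :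
    Hom (r1 + r2) (s1 + s2) :=
  \pi_(Hom (r1 + r2) (s1 + s2)) (tensor_diagram (repr x) (repr y)).

Lemma HomP r s (d e : diagram (r + s)) :
  reflect (code_iso (code_of d) (code_of e)) (\pi_(Hom r s) d == \pi_(Hom r s) e).
Proof. by rewrite eqmodE; apply: asboolP. Qed.

Lemma code_iso_repr r s (d : diagram (r + s)) :
  code_iso (code_of (repr (\pi_(Hom r s) d))) (code_of d).
Proof. by apply/HomP; rewrite reprK. Qed.

Lemma hcompE r s t (d : diagram (r + s)) (e : diagram (s + t)) :
  hcomp (\pi_(Hom r s) d) (\pi_(Hom s t) e) = \pi_(Hom r t) (compose_diagram d e).
Proof. by apply/eqP/HomP/code_iso_compose; exact: code_iso_repr. Qed.

Lemma htensorE r1 s1 r2 s2 (d : diagram (r1 + s1)) (e : diagram (r2 + s2)) :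
  htensor (\pi_(Hom r1 s1) d) (\pi_(Hom r2 s2) e) =
    \pi_(Hom (r1 + r2) (s1 + s2)) (tensor_diagram d e).
Proof. by apply/eqP/HomP/code_iso_tensor; exact: code_iso_repr. Qed.

Local Open Scope ring_scope.

Notation "''T[' k ]_ ( r , s )" := {malg k[Hom r s]}
  (at level 8, k at level 99, r, s at level 99, format "''T[' k ]_ ( r ,  s )").

Definition bilinear_ext (k : comNzRingType) (X Y Z : choiceType)
    (op : X -> Y -> Z) (x : {malg k[X]}) (y : {malg k[Y]}) : {malg k[Z]} :=
  \sum_(a <- msupp x) \sum_(b <- msupp y) << x@_a * y@_b *g op a b >>.

Definition lcomp (k : comNzRingType) r s t (x : 'T[k]_(r, s)) (y : 'T[k]_(s, t)) :
  'T[k]_(r, t) := bilinear_ext (@hcomp r s t) x y.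

Definition ltensor (k : comNzRingType) r1 s1 r2 s2
    (x : 'T[k]_(r1, s1)) (y : 'T[k]_(r2, s2)) :
  'T[k]_(r1 + r2, s1 + s2) := bilinear_ext (@htensor r1 s1 r2 s2) x y.

Record tensor_ideal (k : comNzRingType)
    (J : forall r s, 'T[k]_(r, s) -> Prop) : Prop := TensorIdeal {
  ideal0 : forall r s, J r s 0;
  idealD : forall r s (x y : 'T[k]_(r, s)), J r s x -> J r s y -> J r s (x + y);
  idealZ : forall r s (c : k) (x : 'T[k]_(r, s)), J r s x -> J r s (c *: x);
  ideal_compl : forall r s t (x : 'T[k]_(r, s)) (y : 'T[k]_(s, t)),
    J s t y -> J r t (lcomp x y);
  ideal_compr : forall r s t (x : 'T[k]_(r, s)) (y : 'T[k]_(s, t)),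
    J r s x -> J r t (lcomp x y);
  ideal_tensorl : forall r1 s1 r2 s2
    (x : 'T[k]_(r1, s1)) (y : 'T[k]_(r2, s2)),
    J r2 s2 y -> J (r1 + r2)%N (s1 + s2)%N (ltensor x y);
  ideal_tensorr : forall r1 s1 r2 s2
    (x : 'T[k]_(r1, s1)) (y : 'T[k]_(r2, s2)),
    J r1 s1 x -> J (r1 + r2)%N (s1 + s2)%N (ltensor x y)
}.

(** Membership in the tensor ideal generated by the relations [rel]; a relation
    between diagrams with [m] boundary points is one in [Hom 0 m]. *)
Definition generated_ideal (k : comNzRingType)
    (rel : forall m, 'T[k]_(0, m) -> 'T[k]_(0, m) -> Prop)
    r s (x : 'T[k]_(r, s)) : Prop :=
  forall J : (forall r s, 'T[k]_(r, s) -> Prop),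
    tensor_ideal J ->
    (forall m y z, rel m y z -> J 0%N m (y - z)) ->
    J r s x.

Definition draw (m c : nat) (b : seq nat) (vs : seq (seq nat))
    (v : valid m (c, b, vs)) : Hom 0 m := \pi_(Hom 0 m) (@Diagram m (c, b, vs) v).

Local Open Scope nat_scope.

Definition empty_diagram := @draw 0 0 [::] [::] isT.
Definition circle := @draw 0 1 [::] [::] isT.
Definition tadpole := @draw 1 0 [:: 1] [:: [:: 1; 2; 2]] isT.
Definition arc := @draw 2 0 [:: 1; 1] [::] isT.
Definition bigon := @draw 2 0 [:: 1; 2] [:: [:: 1; 3; 4]; [:: 2; 3; 4]] isT.
Definition vertex := @draw 3 0 [:: 1; 2; 3] [:: [:: 1; 2; 3]] isT.
Definition triangle :=
  @draw 3 0 [:: 1; 2; 3] [:: [:: 1; 4; 5]; [:: 2; 5; 6]; [:: 3; 6; 4]] isT.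

(** The boundary points 1, 2, 3, 4 are in this cyclic order, and the strand
    ending at a univalent boundary point [i] is labelled [i]. *)
Definition diagK := @draw 4 0 [:: 1; 2; 3; 4] [:: [:: 1; 2; 5]; [:: 3; 4; 5]] isT.
Definition diagH := @draw 4 0 [:: 1; 2; 3; 4] [:: [:: 2; 3; 5]; [:: 1; 4; 5]] isT.
Definition diagA := @draw 4 0 [:: 1; 2; 3; 4] [:: [:: 1; 3; 5]; [:: 2; 4; 5]] isT.
Definition diagI := @draw 4 0 [:: 1; 2; 2; 1] [::] isT.
Definition diagU := @draw 4 0 [:: 1; 1; 2; 2] [::] isT.
Definition diagX := @draw 4 0 [:: 1; 2; 1; 2] [::] isT.
Definition square :=
  @draw 4 0 [:: 1; 2; 3; 4]
    [:: [:: 1; 8; 5]; [:: 2; 5; 6]; [:: 3; 6; 7]; [:: 4; 7; 8]] isT.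

Local Close Scope nat_scope.

Section Relations.
Variable k : comAlgType {poly Zsixth}.

Let n : k := 'X%:A.
Let h : k := inv2%:P%:A.

Variant relation : forall m, 'T[k]_(0, m) -> 'T[k]_(0, m) -> Prop :=
| rel_fundamental : @relation 4
    (<< diagK >> + << diagH >> + << diagA >>)
    (2%:R *: << diagI >> + 2%:R *: << diagU >> + 2%:R *: << diagX >>)
| rel_circle : @relation 0 << circle >> (n *: << empty_diagram >>)
| rel_tadpole : @relation 1 << tadpole >> 0
| rel_bigon : @relation 2 << bigon >> ((n + 2%:R) *: << arc >>)
| rel_triangle : @relation 3
    << triangle >> ((h * (2%:R - n)) *: << vertex >>)
| rel_square : @relation 4
    << square >>
    ((h * (6%:R - n)) *: << diagA >> +
     (h * (3%:R * n + 2%:R)) *: << diagI >> +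
     (h * (3%:R * n + 2%:R)) *: << diagU >> -
     (h * (n + 6%:R)) *: << diagX >>).

End Relations.

Definition pF : {poly Zsixth} :=
  ('X - 26%:R) * ('X - 14%:R) * ('X - 8%:R) * ('X - 5%:R) * ('X - 2%:R) ^+ 2 *
  'X * ('X + 1) * ('X + 2%:R).

(* Main.v *)
From Stdlib Require Import BinInt.
Require Import Defs.
From HB Require Import structures.
From mathcomp Require Import all_boot all_order all_algebra.
From mathcomp Require Import finmap boolp monalg.
From mathcomp Require Import ssrZ ring.

Set Implicit Arguments.
Unset Strict Implicit.
Unset Printing Implicit Defensive.

Import Defs.
Import GRing.Theory Num.Theory.

(** Modulo the ideal, a closed diagram with a cycle of length at most 4 is a
    combination of diagrams with fewer vertices: this is what the reduction
    rules say.  A closed diagram without such cycles can be rewritten with the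
    fundamental relation K = - H - A + 2 (I + U + X) at one of its edges.  The
    legs 1, 2 at one end of the edge and 3, 4 at the other end are joined by H
    along 2-3 and 1-4, and by A along 1-3 and 2-4.  If the edge lies on a
    pentagon through one of the first two pairs of legs and on a pentagon
    through one of the last two, then H and A each shorten one of them to a
    square, so all five terms can be reduced further.  In this way the closed
    diagrams met below turn out to be congruent to polynomials in n times the
    empty diagram.

    Nothing guarantees that the polynomial is independent of the choices made,
    and each disagreement puts a polynomial multiple of the empty diagram into
    the ideal.  The theorem comes from one disagreement: a certain graph with 16
    vertices and girth 5, expanded at one edge or at the next one, is congruent
    to p times and to q times the empty diagram, where 16 (p - q) = 9 pF
    ([values_differ]).  Since 9 is invertible, pF times the empty diagram is in
    the ideal ([pF_in_ideal]).

    The two polynomials come from several thousand reduction steps, so they are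
    computed by a function, [evaluate], whose results are proved to be
    congruences ([evaluate_sound]).  Only the gluing has to be understood for
    that: [plug_occurrence] shows that a closed graph that contains the vertices
    of the left-hand side of a rule is that left-hand side glued to the rest of
    the graph.  The occurrences come from a heuristic search, and [expand]
    verifies each of them before using it.

    Polynomials are written in the variable m = n / 2, which makes all the
    coefficients of the rules integral: for instance (6 - n) / 2 = 3 - m. *)

(** * Gluing a pattern into a closed graph *)

Local Open Scope nat_scope.
Local Open Scope quotient_scope.

Lemma count_mem_map_ge (T U : eqType) (f : T -> U) (x y : T) (s : seq T) :
  x != y -> f x = f y ->
  count_mem x s + count_mem y s <= count_mem (f x) (map f s).
Proof.
move=> xy fxy; rewrite count_map -count_predUI.
rewrite (_ : count (predI _ _) s = 0) ?addn0; last first.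
  rewrite -(count_pred0 s); apply: eq_count => z /=.
  by case: eqVneq => // ->; rewrite (negbTE xy).
by apply: sub_count => z /= /orP[]/eqP->; rewrite ?fxy.
Qed.

(** Two labels with the same image would give a label with four ends.  This
    makes the injectivity of a relabelling a matter of counting. *)
Lemma twice_inj (f : nat -> nat) (s : seq nat) :
  twice s -> twice (map f s) -> {in s &, injective f}.
Proof.
move=> /twiceP ts /twiceP tf x y xs ys fxy; apply/eqP; apply: contraT => xy.
have := count_mem_map_ge s xy fxy.
by rewrite ts // ts // tf // map_f.
Qed.

(** If the first strand of each glued pair also ends at a vertex, listed in
    [e], then the strand obtained by gluing still has that end, so it does not
    close up into a circle. *)
Lemma glue_no_circle ps g e :
  {subset unzip1 ps <= e} ->
  twice (map g (unzip1 ps ++ unzip2 ps ++ e)) -> (glue g ps).1 = 0.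
Proof.
elim: ps g => [//|[x0 y0] ps IH] g /= sub tw.
have x0e : x0 \in e by apply: sub; rewrite inE eqxx.
have {}sub : {subset unzip1 ps <= e}.
  by move=> z zp; apply: sub; rewrite inE zp orbT.
set L := unzip1 ps ++ unzip2 ps ++ e.
have {}tw : twice (map g [:: x0, y0 & L]).
  rewrite -(@twice_perm (g x0 :: map g (unzip1 ps ++ y0 :: unzip2 ps ++ e))) //.
  rewrite (@perm_map _ _ g (x0 :: _) [:: x0, y0 & L]) // perm_cons.
  by rewrite -cat1s perm_catCA.
have gxy : g x0 != g y0.
  (* otherwise this label would occur at x0, at y0 and once more in e *)
  apply/eqP => gxy; move/twiceP: tw => /(_ (g x0)).
  rewrite mem_head /= eqxx gxy eqxx => /(_ isT) /eqP.
  rewrite !add1n !eqSS -leqn0 leqNgt -has_count has_pred1 -gxy.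
  by rewrite map_f // !mem_cat x0e !orbT.
rewrite (negbTE gxy); apply: IH => //.
have := @glue_twice [:: (x0, y0)] g L tw.
by rewrite /= (negbTE gxy).
Qed.

Lemma glue_invariant (T : Type) (phi : nat -> T) ps g :
  {in ps, forall p, phi (g p.1) = phi (g p.2)} ->
  forall z, phi ((glue g ps).2 z) = phi (g z).
Proof.
elim: ps g => [//|[x0 y0] ps IH] g /= h z.
have hxy : phi (g x0) = phi (g y0) by apply: (h (x0, y0)); rewrite mem_head.
have {}h : {in ps, forall p, phi (g p.1) = phi (g p.2)}.
  by move=> p pps; apply: h; rewrite inE pps orbT.
have hg w : phi (if g w == g y0 then g x0 else g w) = phi (g w).
  by case: eqP => // ->.
case: eqP => _ /=; first exact: IH.
by rewrite IH => [|p pps]; rewrite !hg //; exact: h.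
Qed.

Definition plug (m : nat) (d e : code) : code := compose_code 0 m d e.

Lemma plug_valid m d e : valid m d -> valid (m + 0) e -> valid 0 (plug m d e).
Proof. by move=> vd ve; exact: (@compose_valid 0 m 0 (Diagram vd) (Diagram ve)). Qed.

(** In a composite the labels of the second diagram are odd and those of the
    first one even; this recovers the original label of the former and applies
    [f] to that of the latter. *)
Definition unlabel (f : nat -> nat) (z : nat) : nat :=
  if odd z then z./2 else f z./2.

Lemma unlabel_double f z : unlabel f (double z) = f z.
Proof. by rewrite /unlabel odd_double doubleK. Qed.

Lemma unlabel_doubleS f z : unlabel f (doubleS z) = z.
Proof. by rewrite /unlabel /= odd_double /= uphalf_double. Qed.

(** The isomorphism is [unlabel f]: it takes the same value on both strands of
    each glued pair, so it does not see the gluing and maps the vertices of the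
    composite back to those of the graph.  It is injective by [twice_inj], since
    the composite and the graph are both valid. *)
Lemma plug_occurrence m (L : code) (f : nat -> nat) c vs rest :
    valid m L -> circles L = 0 ->
    {subset boundary L <= flatten (vertices L)} ->
    valid 0 (c, [::], vs) -> valid (m + 0) (c, map f (boundary L), rest) ->
    same_vertices vs (relabel f (vertices L) ++ rest) ->
  code_iso (c, [::], vs) (plug m L (c, map f (boundary L), rest)).
Proof.
move=> vL cL attached vd ve same.
have vp := plug_valid vL ve.
apply: code_iso_sym; rewrite /plug /compose_code /=.
set e := (c, _, rest).
set bd := map double (boundary L); set be := map doubleS (map f (boundary L)).
have sL : size (boundary L) = m by case/and3P: vL => /eqP.
rewrite !drop0 !take0 /= (take_oversize (n := m)); last by rewrite !size_map sL.
rewrite drop_oversize ?size_map ?sL //=.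
have tL : twice (flatten (vertices L) ++ boundary L).
  case/and3P: vL => _ _; rewrite -/(twice _).
  by apply: etrans; apply: twice_perm; rewrite perm_catC.
have no_circle : (glue id (zip bd be)).1 = 0.
  apply: (@glue_no_circle _ _ (flatten (union_vertices L e))).
    move=> z /mem_unzip1; rewrite flatten_union mem_cat => /mapP[x /attached xL ->].
    by rewrite map_f.
  rewrite map_id unzip1_zip ?unzip2_zip ?size_map //.
  exact: (@twice_union _ _ (Diagram vL) (Diagram ve)).
have inv z : unlabel f ((glue id (zip bd be)).2 z) = unlabel f z.
  apply: glue_invariant => p.
  rewrite /bd /be -map_comp.
  elim: (boundary L) => [//|x s IH]; rewrite /= inE => /orP[/eqP->/=|/IH//].
  by rewrite unlabel_double unlabel_doubleS.
have relab : relabel (unlabel f)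
    (relabel (glue id (zip bd be)).2 (union_vertices L e)) =
    relabel f (vertices L) ++ rest.
  rewrite relabel_comp (eq_relabel (g := unlabel f)) //.
  rewrite /union_vertices /relabel map_cat -!/(relabel _ _) !relabel_comp.
  rewrite (eq_relabel (unlabel_double f)); congr (_ ++ _).
  rewrite (eq_relabel (g := id)); last exact: unlabel_doubleS.
  by rewrite /relabel (eq_map (g := id)) ?map_id // => v; exact: map_id.
split => /=; first by rewrite cL no_circle addn0.
exists (unlabel f); split => //=.
- apply: twice_inj.
    case/and3P: vp => _ _; rewrite -/(twice _) /plug /compose_code /=.
    rewrite -/be -/bd drop0 !take0 drop_oversize ?size_map ?sL //=.
    by rewrite take_oversize ?size_map ?sL.
  rewrite /strand_ends /= map_flatten -/(relabel _ _) relab.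
  case/and3P: vd => _ _; rewrite -/(twice _) /strand_ends /=.
  by rewrite (twice_perm (same_vertices_flatten same)).
- by rewrite relab /same_vertices perm_sym.
Qed.

(** Each gluing doubles the labels; renumbering them keeps them small in a long
    computation with unary numbers. *)
Definition compact (d : code) : code :=
  let labels := undup (flatten (vertices d)) in
  (circles d, [::], relabel (index^~ labels) (vertices d)).

Lemma index_undup_inj (s : seq nat) : {in s &, injective (index^~ (undup s))}.
Proof.
move=> x y; rewrite -!(mem_undup s) => xs ys.
by move/(congr1 (nth 0 (undup s))); rewrite !nth_index.
Qed.

Lemma compact_iso d : valid 0 d -> code_iso d (compact d).
Proof.
case/and3P => /nilP b0 _ _; split=> //.
exists (index^~ (undup (flatten (vertices d)))); rewrite b0; split => //.
- exact: index_undup_inj.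
- exact: perm_refl.
Qed.

Lemma compact_valid d : valid 0 d -> valid 0 (compact d).
Proof.
case/and3P => /nilP b0 s3 tw; apply/and3P; split=> //=.
  by rewrite all_size3_relabel.
rewrite -/(twice _) /strand_ends /= -map_flatten; apply: twice_map.
  exact: index_undup_inj.
by move: tw; rewrite -/(twice _) /strand_ends b0.
Qed.

(** * Integer polynomials as coefficient lists *)

(** Lists of binary integers, constant coefficient first: unlike the
    polynomials over a ring type, these can be computed with. *)
Definition intpoly := seq Z.

Fixpoint addp (p q : intpoly) : intpoly :=
  match p, q with
  | a :: p', b :: q' => Z.add a b :: addp p' q'
  | [::], _ => q
  | _, [::] => p
  end.

Fixpoint mulp (p q : intpoly) : intpoly :=
  if p is a :: p' then addp (map (Z.mul a) q) (Z0 :: mulp p' q) else [::].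

Section Evaluation.
Local Open Scope ring_scope.
Variables (R : comNzRingType) (x : R).

Fixpoint evalp (p : intpoly) : R :=
  if p is a :: p' then (int_of_Z a)%:~R + x * evalp p' else 0.

Lemma evalp_add p q : evalp (addp p q) = evalp p + evalp q.
Proof.
elim: p q => [|a p IH] [|b q] /=; rewrite ?add0r ?addr0 // IH.
by rewrite (rmorphD int_of_Z a b) rmorphD mulrDr addrACA.
Qed.

Lemma evalp_scale a q : evalp (map (Z.mul a) q) = (int_of_Z a)%:~R * evalp q.
Proof.
elim: q => [|b q IH] /=; first by rewrite mulr0.
by rewrite IH (rmorphM int_of_Z a b) rmorphM mulrDr mulrCA.
Qed.

Lemma evalp_mul p q : evalp (mulp p q) = evalp p * evalp q.
Proof.
elim: p => [|a p IH] /=; first by rewrite mul0r.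
by rewrite evalp_add evalp_scale /= IH add0r mulrDl mulrA.
Qed.

Lemma evalp1 a : evalp [:: a] = (int_of_Z a)%:~R.
Proof. by rewrite /= mulr0 addr0. Qed.

Lemma evalp2 a b : evalp [:: a; b] = (int_of_Z a)%:~R + x * (int_of_Z b)%:~R.
Proof. by rewrite /= mulr0 addr0. Qed.

End Evaluation.

(** * Composition with a fixed diagram is linear *)

Section Linear.
Local Open Scope ring_scope.
Variable k : comNzRingType.

(** Total in the code, so that the results of a computation can be used without
    carrying their validity proofs; invalid codes are sent to 0. *)
Definition diag (m : nat) (d : code) : 'T[k]_(0, m) :=
  if insub d is Some D then << \pi_(Hom 0 m) (D : diagram m) >> else 0.

Lemma diagE m d (v : valid m d) : diag m d = << \pi_(Hom 0 m) (@Diagram m d v) >>.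
Proof. by rewrite /diag insubT. Qed.

Lemma drawE m c b vs (v : valid m (c, b, vs)) : << draw v >> = diag m (c, b, vs).
Proof. by rewrite diagE. Qed.

Lemma diag_iso m d e : valid m d -> valid m e -> code_iso d e -> diag m d = diag m e.
Proof. by move=> vd ve de; rewrite !diagE; congr << _ >>; apply/eqP/HomP. Qed.

Lemma mcoeff_lcomp r s t (y : Hom s t) c (x : 'T[k]_(r, s)) (d : {fset Hom r s}) :
  (msupp x `<=` d)%fset ->
  (lcomp x << y >>)@_c = \sum_(a <- d) x@_a *+ (hcomp a y == c).
Proof.
move=> xd; rewrite /lcomp /bilinear_ext raddf_sum /=.
rewrite (eq_bigr (fun a => x@_a *+ (hcomp a y == c))); last first.
  by move=> a _; rewrite msuppU oner_eq0 big_seq_fset1 (mcoeffUU y 1) mulr1 mcoeffU.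
apply: big_fset_incl => // a _ /mcoeff_outdom ->; exact: mul0rn.
Qed.

Lemma lcompD r s t (x x' : 'T[k]_(r, s)) (y : Hom s t) :
  lcomp (x + x') << y >> = lcomp x << y >> + lcomp x' << y >>.
Proof.
apply/malgP => c; apply: etrans (esym (mcoeffD _ _ _)).
have Ex := mcoeff_lcomp y c (fsubsetUl (msupp x) (msupp x')).
have Ex' := mcoeff_lcomp y c (fsubsetUr (msupp x) (msupp x')).
apply: etrans (mcoeff_lcomp y c (msuppD_le x x')) _.
apply: etrans (esym (congr2 +%R Ex Ex')).
by rewrite -big_split; apply: eq_bigr => a _; rewrite (mcoeffD a x x') mulrnDl.
Qed.

Lemma lcompZ r s t a (x : 'T[k]_(r, s)) (y : Hom s t) :
  lcomp (a *: x) << y >> = a *: lcomp x << y >>.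
Proof.
apply/malgP => c; apply: etrans (esym (mcoeffZ _ _ _)).
apply: etrans (mcoeff_lcomp y c (msuppZ_le a x)) _.
apply: etrans (esym (congr1 ( *%R a) (mcoeff_lcomp y c (fsubset_refl _)))).
by rewrite mulr_sumr; apply: eq_bigr => b _; rewrite (mcoeffZ a x b) mulrnAr.
Qed.

Lemma lcompU r s t (x : Hom r s) (y : Hom s t) :
  lcomp (<< x >> : 'T[k]_(r, s)) << y >> = << hcomp x y >>.
Proof.
apply/malgP => c; rewrite (mcoeff_lcomp _ _ (fsubset_refl _)).
by rewrite msuppU oner_eq0 big_seq_fset1 (mcoeffUU x 1) mcoeffU.
Qed.

Lemma lcomp_diag m d e (vd : valid m d) (ve : valid (m + 0) e) :
  lcomp (diag m d) << \pi_(Hom m 0) (Diagram ve) >> = diag 0 (plug m d e).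
Proof.
rewrite (diagE vd) (diagE (plug_valid vd ve)) lcompU (@hcompE 0 m 0).
by congr << \pi_(Hom 0 0) _ >>; apply: val_inj.
Qed.

End Linear.

(** * The rules as data *)

Variant rule := Tadpole | Bigon | Triangle | Square | Fundamental.

Definition arity (r : rule) : nat :=
  match r with
  | Tadpole => 1 | Bigon => 2 | Triangle => 3 | Square => 4 | Fundamental => 4
  end.

Definition K_code : code := (0, [:: 1; 2; 3; 4], [:: [:: 1; 2; 5]; [:: 3; 4; 5]]).
Definition H_code : code := (0, [:: 1; 2; 3; 4], [:: [:: 2; 3; 5]; [:: 1; 4; 5]]).
Definition A_code : code := (0, [:: 1; 2; 3; 4], [:: [:: 1; 3; 5]; [:: 2; 4; 5]]).
Definition I_code : code := (0, [:: 1; 2; 2; 1], [::]).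
Definition U_code : code := (0, [:: 1; 1; 2; 2], [::]).
Definition X_code : code := (0, [:: 1; 2; 1; 2], [::]).

Definition lhs (r : rule) : code :=
  match r with
  | Tadpole => (0, [:: 1], [:: [:: 1; 2; 2]])
  | Bigon => (0, [:: 1; 2], [:: [:: 1; 3; 4]; [:: 2; 3; 4]])
  | Triangle =>
      (0, [:: 1; 2; 3], [:: [:: 1; 4; 5]; [:: 2; 5; 6]; [:: 3; 6; 4]])
  | Square =>
      (0, [:: 1; 2; 3; 4],
       [:: [:: 1; 8; 5]; [:: 2; 5; 6]; [:: 3; 6; 7]; [:: 4; 7; 8]])
  | Fundamental => K_code
  end.

Local Open Scope Z_scope.

(** The coefficients are polynomials in m = n / 2. *)
Definition rhs (r : rule) : seq (intpoly * code) :=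
  match r with
  | Tadpole => [::]
  | Bigon => [:: ([:: 2; 2], (0%N, [:: 1; 1]%N, [::]))]
  | Triangle => [:: ([:: 1; -1], (0%N, [:: 1; 2; 3]%N, [:: [:: 1; 2; 3]%N]))]
  | Square => [:: ([:: 3; -1], A_code); ([:: 1; 3], I_code); ([:: 1; 3], U_code);
                  ([:: -3; -1], X_code)]
  | Fundamental => [:: ([:: -1], H_code); ([:: -1], A_code); ([:: 2], I_code);
                       ([:: 2], U_code); ([:: 2], X_code)]
  end.

Definition circle_power (c : nat) : intpoly := iter c (mulp [:: 0; 2]) [:: 1].

Local Close Scope Z_scope.

Lemma lhs_wf r :
  [/\ valid (arity r) (lhs r), circles (lhs r) = 0 &
      {subset boundary (lhs r) <= flatten (vertices (lhs r))}].
Proof. by case: r; split=> //; apply/allP. Qed.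

Lemma rhs_valid r : all (fun t => valid (arity r) t.2) (rhs r).
Proof. by case: r. Qed.

(** * Evaluating closed graphs *)

(** A rule, the list of the labels that stand for the labels 1, 2, ... of its
    left-hand side (the entry at index 0 is a filler), and the vertices of the
    graph outside that left-hand side. *)
Definition occurrence := (rule * seq nat * seq (seq nat))%type.

Definition context (d : code) (o : occurrence) : code :=
  let: (r, s, rest) := o in (circles d, map (nth 0 s) (boundary (lhs r)), rest).

Fixpoint combine (val : code -> option intpoly) (plugged : code -> code)
    (ts : seq (intpoly * code)) : option intpoly :=
  if ts is (a, e) :: ts' then
    if val (plugged e) is Some p then
      omap (addp (mulp a p)) (combine val plugged ts')
    else None
  else Some [::].

(** The test is what makes the result trustworthy for an arbitrary [o]: it is
    the hypothesis of [plug_occurrence]. *)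
Definition expand (val : code -> option intpoly) (o : occurrence) (d : code) :
    option intpoly :=
  let: (r, s, rest) := o in
  let e := context d o in
  if valid (arity r + 0) e &&
     same_vertices (vertices d) (relabel (nth 0 s) (vertices (lhs r)) ++ rest)
  then combine val (fun t => compact (plug (arity r) t e)) (rhs r)
  else None.

(** Unlike a fold, this stops at the first success when it is computed. *)
Fixpoint first_some (T : Type) (f : nat -> option T) (s : seq nat) : option T :=
  if s is x :: s' then if f x is Some y then Some y else first_some f s' else None.

(** Searches for a trail through [len] vertices that enters the first one by
    the strand [cur] and leaves the last one by the strand [stop].  The answer
    lists, for these vertices in order, the strands that the trail does not use
    and the strands by which it leaves, and then the other vertices. *)
Fixpoint trail (len stop cur : nat) (vs : seq (seq nat)) :
    option (seq nat * seq nat * seq (seq nat)) :=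
  if len is len'.+1 then
    let i := find (fun v => cur \in v) vs in
    if rem cur (nth [::] vs i) is [:: x; y] then
      let rest := take i vs ++ drop i.+1 vs in
      let exit leg out :=
        omap (fun t => (leg :: t.1.1, out :: t.1.2, t.2)) (trail len' stop out rest) in
      if exit x y is Some t then Some t else exit y x
    else None
  else if cur == stop then Some ([::], [::], vs) else None.

Definition find_cycle (len : nat) (vs : seq (seq nat)) :=
  first_some (fun x => trail len x x vs) (flatten vs).

(** In the square, the edges 5, 6, 7, 8 follow the vertices 1, 2, 3, 4; in the
    triangle, the edges 4, 5, 6 precede the vertices 1, 2, 3, hence the
    rotation. *)
Definition short_cycle (vs : seq (seq nat)) : option occurrence :=
  if find_cycle 1 vs is Some (l, e, rest) then Some (Tadpole, 0 :: l ++ e, rest)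
  else if find_cycle 2 vs is Some (l, e, rest) then Some (Bigon, 0 :: l ++ e, rest)
  else if find_cycle 3 vs is Some (l, e, rest) then
    Some (Triangle, 0 :: l ++ rotr 1 e, rest)
  else if find_cycle 4 vs is Some (l, e, rest) then Some (Square, 0 :: l ++ e, rest)
  else None.

Definition edge (x : nat) (vs : seq (seq nat)) : occurrence :=
  let uv := [seq v <- vs | x \in v] in
  (Fundamental, 0 :: flatten (map (rem x) uv) ++ [:: x], [seq v <- vs | x \notin v]).

(** A trail of three vertices between a leg at one end of the edge and a leg at
    the other is a pentagon through the edge; it becomes a square in H or in A,
    according to the two legs. *)
Definition on_two_pentagons (vs : seq (seq nat)) (x : nat) : option occurrence :=
  let o := edge x vs in
  let: (_, s, rest) := o in
  let joined i j := isSome (trail 3 (nth 0 s i) (nth 0 s j) rest) in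
  if (joined 2 3 || joined 1 4) && (joined 1 3 || joined 2 4) then Some o else None.

(** The last case is for graphs without such an edge, for instance those of
    girth 6, in which the fundamental relation at an edge of a hexagon turns the
    hexagon into a pentagon. *)
Definition find_occurrence (d : code) : option occurrence :=
  let vs := vertices d in
  if short_cycle vs is Some o then Some o
  else if first_some (on_two_pentagons vs) (flatten vs) is Some o then Some o
  else Some (edge (head 0 (flatten vs)) vs).

Fixpoint evaluate (fuel : nat) (d : code) : option intpoly :=
  if nilp (vertices d) then Some (circle_power (circles d))
  else if fuel is fuel'.+1 then
    if find_occurrence d is Some o then expand (evaluate fuel') o d else None
  else None.

(** * A graph with two values *)

(** A cycle of length 16, with edges 1 to 16 in order, and eight chords, 17 to
    24.  It has girth 5. *)
Definition hexadecagon : code :=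
  (0, [::],
   [:: [:: 16; 1; 17]; [:: 1; 2; 18]; [:: 2; 3; 19]; [:: 3; 4; 20];
       [:: 4; 5; 21]; [:: 5; 6; 22]; [:: 6; 7; 18]; [:: 7; 8; 23];
       [:: 8; 9; 24]; [:: 9; 10; 22]; [:: 10; 11; 17]; [:: 11; 12; 21];
       [:: 12; 13; 19]; [:: 13; 14; 24]; [:: 14; 15; 20]; [:: 15; 16; 23]]).

Definition value_from (x : nat) : option intpoly :=
  expand (evaluate 14) (edge x (vertices hexadecagon)) hexadecagon.

Local Open Scope Z_scope.

(** The polynomial pF at n = 2 m. *)
Definition pF_half : intpoly :=
  foldr mulp [:: 1]
    [:: [:: -26; 2]; [:: -14; 2]; [:: -8; 2]; [:: -5; 2]; [:: -2; 2]; [:: -2; 2];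
        [:: 0; 2]; [:: 1; 2]; [:: 2; 2]].

Definition difference16 (u v : option intpoly) : option intpoly :=
  if (u, v) is (Some p, Some q) then
    Some (addp (map (Z.mul 16) p) (map (Z.mul (-16)) q))
  else None.

Lemma difference16P u v r : difference16 u v = Some r ->
  exists p q, [/\ u = Some p, v = Some q &
                  r = addp (map (Z.mul 16) p) (map (Z.mul (-16)) q)].
Proof. by case: u v => [p|] [q|] // [<-]; exists p, q. Qed.

(** The multiplier 16 clears the denominator of 9 / 16. *)
Lemma values_differ :
  difference16 (value_from 2) (value_from 3) = Some (map (Z.mul 9) pF_half).
Proof. by vm_compute. Qed.

Local Close Scope Z_scope.

(** * Soundness of the evaluation *)

Lemma halved_coefficients (R : comNzRingType) (h n x : R) :
    (h * 2%:R = 1 -> n = x * 2%:R ->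
  [/\ h * (2%:R - n) = 1 + x * -1, h * (6%:R - n) = 3%:R + x * -1,
      h * (3%:R * n + 2%:R) = 1 + x * 3%:R &
      - (h * (n + 6%:R)) = - 3%:R + x * -1])%R.
Proof.
move=> hE nE.
have affine a b : (h * (a * 2%:R + b * n) = a + x * b)%R.
  by rewrite nE mulrA -mulrDl mulrCA hE mulr1 [(b * x)%R]mulrC.
by split; rewrite -affine; ring.
Qed.

Definition inv3 : Zsixth := @ToZsixth (3%:R^-1)%R isT.

Section Soundness.
Local Open Scope ring_scope.
Variable k : comAlgType {poly Zsixth}.
Variable J : forall r s, 'T[k]_(r, s) -> Prop.
Hypothesis J_ideal : tensor_ideal J.
Hypothesis J_rel : forall m y z, @relation k m y z -> J (y - z).

Let n : k := 'X%:A.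
Let h : k := inv2%:P%:A.
Let m : k := h * n.

Lemma half_double : h * 2%:R = 1.
Proof.
have -> : 2%:R = (2%:R : {poly Zsixth})%:A :> k by rewrite scaler_nat.
rewrite /h -scalerAl mul1r scalerA -polyC_natr -polyCM.
by rewrite (_ : inv2 * 2%:R = 1) ?scale1r //; apply: val_inj.
Qed.

Lemma double_half_n : n = m * 2%:R.
Proof. by rewrite /m mulrAC half_double mul1r. Qed.

Lemma ninth : exists z : k, z * 9%:R = 1.
Proof.
exists (inv3 ^+ 2)%:P%:A.
have -> : 9%:R = (9%:R : {poly Zsixth})%:A :> k by rewrite scaler_nat.
rewrite -scalerAl mul1r scalerA -polyC_natr -polyCM.
by rewrite (_ : inv3 ^+ 2 * 9%:R = 1) ?scale1r //; apply: val_inj.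
Qed.

Definition reduces l (d : code) (ts : seq (intpoly * code)) : Prop :=
  J (diag k l d - \sum_(t <- ts) evalp m t.1 *: diag k l t.2).

Lemma four_pointE :
  (diag k 4 K_code = << diagK >>) * (diag k 4 H_code = << diagH >>) *
  (diag k 4 A_code = << diagA >>) * (diag k 4 I_code = << diagI >>) *
  (diag k 4 U_code = << diagU >>) * (diag k 4 X_code = << diagX >>) *
  (diag k 4 (lhs Square) = << square >>).
Proof. by do !split; exact: diagE. Qed.

Lemma tadpole_reduces : reduces 1 (lhs Tadpole) (rhs Tadpole).
Proof.
have H : J (<< tadpole >> - 0) := J_rel (rel_tadpole k).
by rewrite /reduces big_nil -drawE.
Qed.

Lemma bigon_reduces : reduces 2 (lhs Bigon) (rhs Bigon).
Proof.
have H : J (<< bigon >> - (n + 2%:R) *: << arc >>) := J_rel (rel_bigon k).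
rewrite /reduces big_seq1 evalp2 -!drawE.
by have -> : 2%:R + m * 2%:R = n + 2%:R by rewrite double_half_n addrC.
Qed.

Lemma triangle_reduces : reduces 3 (lhs Triangle) (rhs Triangle).
Proof.
have H : J (<< triangle >> - (h * (2%:R - n)) *: << vertex >>) :=
  J_rel (rel_triangle k).
rewrite /reduces big_seq1 evalp2 -!drawE.
by have [<- _ _ _] := halved_coefficients half_double double_half_n; exact: H.
Qed.

Lemma square_reduces : reduces 4 (lhs Square) (rhs Square).
Proof.
have H : J (<< square >> -
    ((h * (6%:R - n)) *: << diagA >> + (h * (3%:R * n + 2%:R)) *: << diagI >> +
     (h * (3%:R * n + 2%:R)) *: << diagU >> - (h * (n + 6%:R)) *: << diagX >>)) :=
  J_rel (rel_square k).
rewrite /reduces 3!big_cons big_seq1 !evalp2 !four_pointE.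
have [_ <- <- <-] := halved_coefficients half_double double_half_n.
have assoc (V : lmodType k) (s a b c : V) l d :
    s - (a + b + c - l *: d) = s - (a + (b + (c + (- l) *: d))).
  by rewrite scaleNr !addrA.
exact: (eq_ind _ (@J 0 4) H _ (assoc _ _ _ _ _ _ _)).
Qed.

Lemma fundamental_reduces : reduces 4 (lhs Fundamental) (rhs Fundamental).
Proof.
have H : J (<< diagK >> + << diagH >> + << diagA >> -
    (2%:R *: << diagI >> + 2%:R *: << diagU >> + 2%:R *: << diagX >>)) :=
  J_rel (rel_fundamental k).
rewrite /reduces 4!big_cons big_seq1.
have -> : evalp m [:: Zneg 1] = -1 by exact: evalp1.
have -> : evalp m [:: Zpos 2] = 2%:R by exact: evalp1.
rewrite !four_pointE.
have assoc (V : lmodType k) (a b c u v w : V) :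
    a + b + c - (u + v + w) = a - (-1 *: b + (-1 *: c + (u + (v + w)))).
  by rewrite !scaleN1r !opprD !opprK !addrA.
exact: (eq_ind _ (@J 0 4) H _ (assoc _ _ _ _ _ _ _)).
Qed.

Lemma rule_reduces r : reduces (arity r) (lhs r) (rhs r).
Proof.
case: r.
- exact: tadpole_reduces.
- exact: bigon_reduces.
- exact: triangle_reduces.
- exact: square_reduces.
- exact: fundamental_reduces.
Qed.

Lemma reduces_plug l d ts e :
    valid l d -> all (fun t => valid l t.2) ts -> valid (l + 0) e ->
  reduces l d ts -> reduces 0 (plug l d e) [seq (t.1, plug l t.2 e) | t <- ts].
Proof.
move=> vd vts ve /(ideal_compr J_ideal << \pi_(Hom l 0) (Diagram ve) >>).
rewrite /reduces -[in X in X -> _]scaleN1r lcompD lcompZ scaleN1r lcomp_diag //.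
congr (J (_ - _)); elim: ts vts => [_|t ts IH /=/andP[vt vts]].
  by rewrite !big_nil -(scale0r 0) lcompZ scale0r.
by rewrite !big_cons lcompD lcompZ lcomp_diag // IH.
Qed.

Definition has_value (d : code) (p : intpoly) : Prop :=
  J (diag k 0 d - evalp m p *: << empty_diagram >>).

Lemma ideal_sub r s (u v : 'T[k]_(r, s)) : J u -> J v -> J (u - v).
Proof.
move=> Ju Jv; rewrite -scaleN1r; apply: (idealD J_ideal) => //.
exact: (idealZ J_ideal).
Qed.

Lemma has_value_iso d e p :
  valid 0 d -> valid 0 e -> code_iso d e -> has_value e p -> has_value d p.
Proof. by move=> vd ve de; rewrite /has_value (diag_iso k vd ve de). Qed.

Lemma combine_sound (val : code -> option intpoly) plugged d ts p :
    (forall t q, t \in ts -> val (plugged t.2) = Some q ->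
       has_value (plugged t.2) q) ->
    reduces 0 d [seq (t.1, plugged t.2) | t <- ts] ->
  combine val plugged ts = Some p -> has_value d p.
Proof.
move=> val_ts; rewrite /reduces /has_value => red comb.
rewrite -[diag k 0 d](subrK (\sum_(t <- [seq (t.1, plugged t.2) | t <- ts])
   evalp m t.1 *: diag k 0 t.2)) -addrA.
apply: (idealD J_ideal) => {red} //.
elim: ts p val_ts comb => [|[a e] ts IH] p val_ts /=.
  by move=> [<-]; rewrite big_nil /= scale0r subrr; exact: (ideal0 J_ideal).
case eq_q: (val (plugged e)) => [q|//].
case eq_p: (combine _ _ ts) => [p'|//] [<-].
rewrite big_cons evalp_add evalp_mul scalerDl opprD addrACA -scalerA -scalerBr.
apply: (idealD J_ideal).
  by apply: (idealZ J_ideal); apply: (val_ts (a, e)) => //; rewrite mem_head.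
by apply: IH => // t u tts; apply: val_ts; rewrite inE tts orbT.
Qed.

Lemma circle_power_value c : has_value (c, [::], [::]) (circle_power c).
Proof.
elim: c => [|c IH].
  by rewrite /has_value evalp1 scale1r -drawE subrr; exact: (ideal0 J_ideal).
have red : reduces 0 (1, [::], [::]) [:: ([:: Z0; Zpos 2], (0, [::], [::]))].
  have H : J (<< circle >> - n *: << empty_diagram >>) := J_rel (rel_circle k).
  rewrite /reduces big_seq1 evalp2 -!drawE.
  by have -> : 0 + m * 2%:R = n by rewrite add0r double_half_n.
have v (i : nat) : valid (0 + 0) (i, [::], [::]) by [].
have plug_circles i : plug 0 (i, [::], [::]) (c, [::], [::]) = (i + c, [::], [::]).
  by rewrite /plug /compose_code /= addn0.
have := reduces_plug (v 1) _ (v c) red.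
rewrite /reduces big_seq1 !plug_circles => /(_ isT) red_c.
have telescope (V : lmodType k) a (u w e : V) :
    (u - a *: w) + a *: (w - e) = u - a *: e.
  by rewrite scalerBr addrA subrK.
rewrite /has_value evalp_mul -scalerA.
exact: (eq_ind _ (@J 0 0) (idealD J_ideal red_c (idealZ J_ideal _ IH)) _
  (telescope _ _ _ _ _)).
Qed.

Lemma no_vertices_value d :
  valid 0 d -> vertices d = [::] -> has_value d (circle_power (circles d)).
Proof.
case: d => [[c b] vs] /and3P[/nilP]; rewrite /boundary /vertices /= => -> _ _ ->.
exact: circle_power_value.
Qed.

(** The test in [expand] gives the hypotheses of [plug_occurrence], so the graph
    is the left-hand side of the rule plugged into the context, and the rule
    itself can be plugged into the same context. *)
Lemma expand_sound (val : code -> option intpoly) o d p :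
    (forall e q, valid 0 e -> val e = Some q -> has_value e q) ->
    valid 0 d -> expand val o d = Some p -> has_value d p.
Proof.
case: o => [[r s] rest] val_sound vd; rewrite /expand.
case: ifP => // /andP[ve same].
have [vl cl attached] := lhs_wf r.
have boundary_d : boundary d = [::] by case/and3P: vd => /nilP.
case: d => [[c b] vs] /= in vd ve same boundary_d *.
rewrite /boundary /= in boundary_d; rewrite {}boundary_d in vd *.
have iso := plug_occurrence vl cl attached vd ve same.
set e := (c, _, rest) in ve iso *.
have v_plug t : t \in rhs r -> valid 0 (plug (arity r) t.2 e).
  by move=> /(allP (rhs_valid r)) vt; exact: plug_valid.
move=> comb; apply: (has_value_iso vd (plug_valid vl ve) iso).
apply: combine_sound comb => [t q tr|].
  by apply: val_sound; apply: compact_valid; exact: v_plug.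
have compactE :
    \sum_(t <- rhs r) evalp m t.1 *: diag k 0 (compact (plug (arity r) t.2 e)) =
    \sum_(t <- rhs r) evalp m t.1 *: diag k 0 (plug (arity r) t.2 e).
  apply: eq_big_seq => t /v_plug vt; congr (_ *: _); apply: esym.
  by apply: diag_iso; [exact: vt | exact: compact_valid | exact: compact_iso].
have := reduces_plug vl (rhs_valid r) ve (rule_reduces r).
rewrite /reduces !big_map => red.
exact: (eq_ind _ (fun w => J (diag k 0 (plug (arity r) (lhs r) e) - w)) red _
  (esym compactE)).
Qed.

Lemma evaluate_sound fuel d p :
  valid 0 d -> evaluate fuel d = Some p -> has_value d p.
Proof.
elim: fuel d p => [|fuel IH] d p vd /=; case: nilP => [vs0|_] //.
- by move=> [<-]; exact: no_vertices_value.
- by move=> [<-]; exact: no_vertices_value.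
- by case: (find_occurrence d) => // o; exact: expand_sound.
Qed.

Lemma value_from_sound i p : value_from i = Some p -> has_value hexadecagon p.
Proof. by apply: expand_sound => // e q; exact: evaluate_sound. Qed.

Lemma pF_halfE : evalp m pF_half = pF%:A.
Proof.
rewrite /pF_half /foldr !evalp_mul !evalp2 evalp1 -double_half_n.
have algM (u v : {poly Zsixth}) : (u * v)%:A = u%:A * v%:A :> k.
  by rewrite -scalerAl mul1r scalerA.
have algB i : ('X - i%:R)%:A = n - i%:R :> k by rewrite scalerBl scaler_nat.
have algD i : ('X + i%:R)%:A = n + i%:R :> k by rewrite scalerDl scaler_nat.
rewrite /pF expr2 !algM !algB (algD 1) (algD 2) -/n.
have -> : (int_of_Z Z0)%:~R = 0 :> k by [].
have -> : (int_of_Z (Zpos 1))%:~R = 1 :> k by [].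
by rewrite add0r mulr1 !(addrC _ n) -!mulrA.
Qed.

Lemma pF_in_ideal : J ((pF%:A : k) *: << empty_diagram >>).
Proof.
have [p [q [/value_from_sound v2 /value_from_sound v3 diff]]] :=
  difference16P values_differ.
have [z z9] := ninth.
have pFE : pF%:A = (z * 16%:R) * (evalp m p - evalp m q).
  have : 16%:R * evalp m p + - 16%:R * evalp m q = 9%:R * pF%:A.
    by rewrite -pF_halfE -(evalp_scale m (Zpos 9)) diff evalp_add !evalp_scale.
  move: (pF%:A) => PF; rewrite mulNr -mulrBr => diffE.
  by rewrite -mulrA diffE mulrA z9 mul1r.
have cancel (V : lmodType k) (D E : V) l a b :
    l *: ((D - b *: E) - (D - a *: E)) = (l * (a - b)) *: E.
  by rewrite opprB addrC addrA subrK -scalerBl scalerA.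
rewrite pFE.
exact: (eq_ind _ (@J 0 0) (idealZ J_ideal _ (ideal_sub v3 v2)) _
  (cancel _ _ _ _ _ _)).
Qed.

End Soundness.

Local Open Scope ring_scope.

Theorem theorem3p3 (k : comAlgType {poly Zsixth}) :
  generated_ideal (@relation k) (pF%:A *: << empty_diagram >> : 'T[k]_(0, 0)).
Proof. by move=> J J_ideal J_rel; exact: pF_in_ideal. Qed.
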